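(* Let $a,b_1,b_2$ be complex parameters, and let $s$ be any complex constant with $s^2\neq1$. The following univariate specializations of Appell's $F_2(x,y)$ function satisfy ordinary Fuchsian equations of second order (with respect to $x$, respectively $t$): $$F_2(a;b_1,b_2;2b_1,2b_2;\;x,\,2-x),$$ $$F_2\!\left(b_1+b_2-\tfrac12;\,b_1,b_2;\,2b_1,2b_2;\;1-t^2,\;1-\frac{(t+s)^2}{s^2-1}\right).$$
   Context: $(\alpha)_n=\alpha(\alpha+1)\cdots(\alpha+n-1)$. Appell's series is $$F_2(a;b_1,b_2;c_1,c_2;x,y)=\sum_{n,m\ge 0}\frac{(a)_{n+m}(b_1)_n(b_2)_m}{(c_1)_n(c_2)_m\,n!\,m!}x^ny^m .$$ It satisfies the rank 4 holonomic system $$x(1-x)F_{xx}-xyF_{xy}+(c_1-(a+b_1+1)x)F_x-b_1yF_y-ab_1F=0,$$ $$y(1-y)F_{yy}-xyF_{xy}+(c_2-(a+b_2+1)y)F_y-b_2xF_x-ab_2F=0 .$$ An ODE is Fuchsian if it is linear, homogeneous, with rational coefficients and only regular singularities on $\mathbf P^1$. Univariate specialization: for a holomorphic map $\Phi:t\mapsto(x(t),y(t))$ from an open subset of $\mathbf C$ to $\mathbf C^2$, $F(x(t),y(t))=F\circ\Phi$. The partial differential form under $\Phi$ of an ODE $E$ in $t$ is obtained by replacing $t$-derivatives by partial derivatives via the chain rule ($\frac{dF}{dt}=\dot xF_x+\dot yF_y$, etc.). The specialized form under $\Phi$ of a linear PDE is obtained by substituting $x=x(t),y=y(t)$ into the coefficients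 of the partial derivatives. $E$ follows fully from a PDE system $H$ under $\Phi$ if its partial differential form coincides with the specialized form of some PDE that follows from $H$ by algebraic and partial differentiation operations. The ODE satisfied by a univariate specialization of an Appell function is understood as one following fully from its PDE system (so it is satisfied by $F\circ\Phi$ for every solution $F$ of the system holomorphic on the image of $\Phi$). *)

(* Defs.v *)
From HB Require Import structures.
From mathcomp Require Import all_boot all_order all_algebra.
From mathcomp Require Import generic_quotient fraction.
From mathcomp Require Import complex reals.

Set Implicit Arguments.
Unset Strict Implicit.
Unset Printing Implicit Defensive.

Import GRing.Theory.
Local Open Scope ring_scope.

Notation "x %:F" := (@FracField.tofrac _ x).

(* Extension to the fraction field, by the quotient rule, of a derivation D. *)
Definition fracD (A : idomainType) (D : A -> A) (f : {fraction A}) :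
    {fraction A} :=
  let n := \n_(repr f) in let d := \d_(repr f) in
  (D n * d - n * D d)%:F / (d ^+ 2)%:F.

Section UnivariateSpecialization.

Variable C : fieldType.

(* C(t) *)
Definition rat1 : fieldType := {fraction {poly C}}.

(* C(x, y). In {poly {poly C}} the inner variable is x, the outer one is y. *)
Definition rat2 : fieldType := {fraction {poly {poly C}}}.

Definition cst1 (c : C) : rat1 := c%:P%:F.
Definition cst2 (c : C) : rat2 := c%:P%:P%:F.

Definition tvar : rat1 := ('X : {poly C})%:F.
Definition xvar : rat2 := ('X%:P : {poly {poly C}})%:F.
Definition yvar : rat2 := ('X : {poly {poly C}})%:F.

Definition ddt : rat1 -> rat1 := fracD (@deriv C).
Definition ddx : rat2 -> rat2 := fracD (map_poly (@deriv C)).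
Definition ddy : rat2 -> rat2 := fracD (@deriv {poly C}).

(* A linear homogeneous equation \sum_k e_k (d/dt)^k F = 0 is encoded by the
   polynomial \sum_k e_k 'X^k. *)
Definition ode := {poly rat1}.

(* A linear homogeneous equation \sum p_ij (d/dx)^i (d/dy)^j F = 0 is encoded
   by a polynomial in the symbols Dx (inner variable) and Dy (outer variable)
   with coefficient p_ij = P`_j`_i. Coefficients stand to the left of the
   derivations; the commutative product is not the composition of operators. *)
Definition pform (K : fieldType) := {poly {poly K}}.
Definition pde := pform rat2.

Definition Dx {K : fieldType} : pform K := 'X%:P.
Definition Dy {K : fieldType} : pform K := 'X.
Definition pcoef {K : fieldType} (c : K) : pform K := c%:P%:P.

(* Partial derivatives of an equation, by the Leibniz rule. *)
Definition pde_dx (P : pde) : pde := map_poly (map_poly ddx) P + Dx * P.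
Definition pde_dy (P : pde) : pde := map_poly (map_poly ddy) P + Dy * P.

(* Consequences of a system by algebraic and partial differentiation
   operations, i.e. the left ideal it generates over C(x, y). *)
Inductive pde_follows (H : seq pde) : pde -> Prop :=
  | follows_mem P : P \in H -> pde_follows H P
  | follows_add P Q :
      pde_follows H P -> pde_follows H Q -> pde_follows H (P + Q)
  | follows_mul (f : rat2) P : pde_follows H P -> pde_follows H (pcoef f * P)
  | follows_dx P : pde_follows H P -> pde_follows H (pde_dx P)
  | follows_dy P : pde_follows H P -> pde_follows H (pde_dy P).

(* Substitution of rational functions of t into polynomials. *)
Definition subst1 (x : rat1) (p : {poly C}) : rat1 := (map_poly cst1 p).[x].
Definition subst2 (x y : rat1) (p : {poly {poly C}}) : rat1 :=
  (map_poly (subst1 x) p).[y].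

(* g is the result of substituting x(t), y(t) into f; this requires f to have
   a denominator that does not vanish identically along the curve. *)
Definition rat2_specializes (x y : rat1) (f : rat2) (g : rat1) : Prop :=
  exists n d : {poly {poly C}},
    [/\ subst2 x y d != 0, f = n%:F / d%:F & g = subst2 x y n / subst2 x y d].

Definition pde_specializes (x y : rat1) (P : pde) (Q : pform rat1) : Prop :=
  forall i j : nat, rat2_specializes x y (P`_j`_i) (Q`_j`_i).

(* d/dt of a linear expression in the partial derivatives of F along the curve
   (x(t), y(t)), with coefficients depending on t. *)
Definition chain_ddt (x y : rat1) (Q : pform rat1) : pform rat1 :=
  map_poly (map_poly ddt) Q
  + pcoef (ddt x) * Dx * Q + pcoef (ddt y) * Dy * Q.

Definition partial_diff_form (x y : rat1) (E : ode) : pform rat1 :=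
  \sum_(k < size E) pcoef E`_k * iter k (chain_ddt x y) 1.

Definition follows_fully (x y : rat1) (H : seq pde) (E : ode) : Prop :=
  exists2 P : pde, pde_follows H P
                 & pde_specializes x y P (partial_diff_form x y E).

Definition ode_order (E : ode) : nat := (size E).-1.

Definition holomorphic_at (t0 : C) (f : rat1) : Prop :=
  exists n d : {poly C}, d.[t0] != 0 /\ f = n%:F / d%:F.

(* t0 is an ordinary point or a regular singularity: for the equation
   F^(n) + p_1 F^(n-1) + ... + p_n F = 0, each p_i has at t0 a pole of order
   at most i. *)
Definition regular_at (t0 : C) (E : ode) : Prop :=
  forall k : nat, (k <= ode_order E)%N ->
    holomorphic_at t0
      ((tvar - cst1 t0) ^+ (ode_order E - k) * (E`_k / lead_coef E)).

(* The equation in the local parameter z = 1/t at infinity, where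
   d/dt = - z^2 d/dz; the variable of rat1 now plays the role of z. *)
Definition subst_inv (f : rat1) : rat1 :=
  subst1 tvar^-1 \n_(repr f) / subst1 tvar^-1 \d_(repr f).

Definition inv_ddt (Q : ode) : ode :=
  (- tvar ^+ 2) *: (map_poly ddt Q + 'X * Q).

Definition ode_at_infinity (E : ode) : ode :=
  \sum_(k < size E) subst_inv E`_k *: iter k inv_ddt 1.

Definition fuchsian (E : ode) : Prop :=
  [/\ E != 0, (forall t0 : C, regular_at t0 E)
    & regular_at 0 (ode_at_infinity E)].

Definition F2_eq1 (a b1 c1 : C) : pde :=
  let x := xvar in let y := yvar in
  pcoef (x * (1 - x)) * Dx ^+ 2 - pcoef (x * y) * (Dx * Dy)
  + pcoef (cst2 c1 - cst2 (a + b1 + 1) * x) * Dx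
  - pcoef (cst2 b1 * y) * Dy - pcoef (cst2 (a * b1)).

Definition F2_eq2 (a b2 c2 : C) : pde :=
  let x := xvar in let y := yvar in
  pcoef (y * (1 - y)) * Dy ^+ 2 - pcoef (x * y) * (Dx * Dy)
  + pcoef (cst2 c2 - cst2 (a + b2 + 1) * y) * Dy
  - pcoef (cst2 b2 * x) * Dx - pcoef (cst2 (a * b2)).

(* The system satisfied by Appell's series F_2(a; b1, b2; c1, c2; x, y). *)
Definition F2_system (a b1 b2 c1 c2 : C) : seq pde :=
  [:: F2_eq1 a b1 c1; F2_eq2 a b2 c2].

(* F_2(a; b1, b2; c1, c2; x(t), y(t)) satisfies the equation E. *)
Definition F2_specialization_satisfies
    (a b1 b2 c1 c2 : C) (x y : rat1) (E : ode) : Prop :=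
  follows_fully x y (F2_system a b1 b2 c1 c2) E.

End UnivariateSpecialization.

Arguments tvar {C}.
Arguments xvar {C}.
Arguments yvar {C}.

(* Main.v *)
From HB Require Import structures.
From mathcomp Require Import all_boot all_order all_algebra.
From mathcomp Require Import complex reals generic_quotient fraction ring.
Require Import Defs.
Import GRing.Theory.

Set Implicit Arguments.
Unset Strict Implicit.
Unset Printing Implicit Defensive.

Local Open Scope ring_scope.

(** Along each of the two curves, a combination [g1 * eq1 + g2 * eq2] of the two
    F2 equations already has as its second-order part a multiple [e2] of
    [x'^2 Fxx + 2 x' y' Fxy + y'^2 Fyy]; no differentiation is needed.  Matching
    Fxx and Fyy forces [g1 x (1 - x) = e2 x'^2] and [g2 y (1 - y) = e2 y'^2].
    On [(t, 2 - t)] take [g1 = y], [g2 = - x] and [e2 = x y (1 - x)]; on the conic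
    take [g1 = 4 k y], [g2 = 4 x] and [e2 = k x y] with [k = s^2 - 1].  Since
    [c_i = 2 b_i], the first-order parts are compatible with a single
    coefficient [e1].  The resulting equation has polynomial coefficients
    [e2], [e1], [e0], where [e2] has only simple roots and the degrees drop by
    at least one at each step: such an equation is Fuchsian. *)

(** * Substitution, second-order forms and the chain rule along a curve *)

Section SecondOrderForms.

Lemma frac_numden (A : idomainType) (f : {fraction A}) :
  f * (\d_(repr f))%:F = (\n_(repr f))%:F.
Proof.
rewrite -[f in f * _]reprK; set r := repr f.
rewrite /FracField.tofrac; unlock; rewrite -[LHS]FracField.pi_mul.
apply/eqmodP/eqP; rewrite /= /FracField.mulf.
by rewrite !numden_Ratio ?oner_neq0 // ?mulr1 ?denom_ratioP // mulrC.
Qed.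

(** [fracD] and [subst_inv] compute with whichever representative [repr] picks. For a polynomial p
    it has the form p d / d with d unknown, and this relation lets d cancel. *)
Lemma repr_tofrac (A : idomainType) (p : A) :
  \n_(repr p%:F) = p * \d_(repr p%:F).
Proof. by apply/eqP; rewrite -tofrac_eq -frac_numden tofracM. Qed.

Variable C : fieldType.

Lemma ddt_tofrac (p : {poly C}) : ddt p%:F = (p^`())%:F.
Proof.
rewrite /ddt /fracD repr_tofrac; set d := \d_ _.
have d0 : (d ^+ 2)%:F != 0 :> {fraction {poly C}}.
  by rewrite tofrac_eq0 expf_neq0 ?denom_ratioP.
apply: (mulIf d0); rewrite divfK // -tofracM; congr _%:F.
(* Quotient rule on p d / d: (p d)' d - p d d' = p' d^2. *)
by rewrite derivM; ring.
Qed.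

Lemma ddt0 : ddt 0 = 0 :> rat1 C.
Proof. by rewrite -[X in ddt X]tofrac0 ddt_tofrac deriv0 tofrac0. Qed.

Lemma ddt1 : ddt 1 = 0 :> rat1 C.
Proof. by rewrite -[X in ddt X]tofrac1 ddt_tofrac derivC tofrac0. Qed.

HB.instance Definition _ := GRing.RMorphism.copy (@cst1 C)
  ((@FracField.tofrac {poly C}) \o polyC).
HB.instance Definition _ := GRing.RMorphism.copy (@cst2 C)
  ((@FracField.tofrac {poly {poly C}}) \o (polyC \o polyC)).

Lemma subst1_zmod_morphism (x : rat1 C) : zmod_morphism (subst1 x).
Proof. by move=> p q; rewrite /subst1 rmorphB hornerD hornerN. Qed.
Lemma subst1_monoid_morphism (x : rat1 C) : monoid_morphism (subst1 x).
Proof.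
by split=> [|p q]; rewrite /subst1 ?rmorph1 ?hornerC// rmorphM hornerM.
Qed.
HB.instance Definition _ (x : rat1 C) := GRing.isZmodMorphism.Build
  {poly C} (rat1 C) (subst1 x) (subst1_zmod_morphism x).
HB.instance Definition _ (x : rat1 C) := GRing.isMonoidMorphism.Build
  {poly C} (rat1 C) (subst1 x) (subst1_monoid_morphism x).

Lemma subst2_zmod_morphism (x y : rat1 C) : zmod_morphism (subst2 x y).
Proof. by move=> p q; rewrite /subst2 rmorphB hornerD hornerN. Qed.
Lemma subst2_monoid_morphism (x y : rat1 C) : monoid_morphism (subst2 x y).
Proof.
by split=> [|p q]; rewrite /subst2 ?rmorph1 ?hornerC// rmorphM hornerM.
Qed.
HB.instance Definition _ (x y : rat1 C) := GRing.isZmodMorphism.Build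
  {poly {poly C}} (rat1 C) (subst2 x y) (subst2_zmod_morphism x y).
HB.instance Definition _ (x y : rat1 C) := GRing.isMonoidMorphism.Build
  {poly {poly C}} (rat1 C) (subst2 x y) (subst2_monoid_morphism x y).

Section Specialization.
Variables x y : rat1 C.

Lemma specializes_poly (p : {poly {poly C}}) :
  rat2_specializes x y p%:F (subst2 x y p).
Proof. by exists p, 1; rewrite rmorph1 oner_neq0 tofrac1 !divr1. Qed.

Lemma specializes_cst (c : C) : rat2_specializes x y (cst2 c) (cst1 c).
Proof.
have -> : cst1 c = subst2 x y c%:P%:P; last exact: specializes_poly.
by rewrite /subst2 map_polyC hornerC /= /subst1 map_polyC hornerC.
Qed.

Lemma specializes_xvar : rat2_specializes x y xvar x.
Proof.
suff {2}-> : x = subst2 x y 'X%:P by exact: specializes_poly.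
by rewrite /subst2 map_polyC hornerC /= /subst1 map_polyX hornerX.
Qed.

Lemma specializes_yvar : rat2_specializes x y yvar y.
Proof.
suff {2}-> : y = subst2 x y 'X by exact: specializes_poly.
by rewrite /subst2 map_polyX hornerX.
Qed.

Lemma subst2D p q : subst2 x y (p + q) = subst2 x y p + subst2 x y q.
Proof. exact: rmorphD. Qed.

Lemma subst2M p q : subst2 x y (p * q) = subst2 x y p * subst2 x y q.
Proof. exact: rmorphM. Qed.

Lemma specializesN f g :
  rat2_specializes x y f g -> rat2_specializes x y (- f) (- g).
Proof.
by move=> [n [d [d0 -> ->]]]; exists (- n), d; rewrite !rmorphN !mulNr.
Qed.

Lemma subst2_neq0 d : subst2 x y d != 0 -> d%:F != 0 :> rat2 C.
Proof. by rewrite tofrac_eq0; apply: contraNneq => ->; rewrite rmorph0. Qed.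

(** The product of two denominators that do not vanish along the curve does not vanish either,
    because C(t) is a field. *)
Lemma specializesD f g f' g' :
  rat2_specializes x y f g -> rat2_specializes x y f' g' ->
  rat2_specializes x y (f + f') (g + g').
Proof.
move=> [n [d [d0 -> ->]]] [n' [d' [d0' -> ->]]].
exists (n * d' + n' * d), (d * d'); split.
- rewrite subst2M.
  exact: mulf_neq0 d0 d0'.
- by rewrite tofracD !tofracM addf_div //; exact: subst2_neq0.
- by rewrite subst2D !subst2M addf_div.
Qed.

Lemma specializesM f g f' g' :
  rat2_specializes x y f g -> rat2_specializes x y f' g' ->
  rat2_specializes x y (f * f') (g * g').
Proof.
move=> [n [d [d0 -> ->]]] [n' [d' [d0' -> ->]]].
exists (n * n'), (d * d'); split.
- rewrite subst2M.
  exact: mulf_neq0 d0 d0'.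
- by rewrite !tofracM mulf_div.
- by rewrite !subst2M mulf_div.
Qed.

Lemma specializes1 : rat2_specializes x y 1 1.
Proof. by rewrite -(rmorph1 (@cst2 C)) -(rmorph1 (@cst1 C)); exact: specializes_cst. Qed.

Lemma specializes0 : rat2_specializes x y 0 0.
Proof. by rewrite -(rmorph0 (@cst2 C)) -(rmorph0 (@cst1 C)); exact: specializes_cst. Qed.
End Specialization.

(** The rows are indexed by the power of [Dy] and the entries of a row by the power of [Dx]. With
    coefficients listed explicitly, specialization and differentiation can be checked entry by
    entry. *)
Definition quadratic_pform (K : fieldType) (axx axy ayy ax ay a0 : K) :
    pform K :=
  Poly [:: Poly [:: a0; ax; axx]; Poly [:: ay; axy]; Poly [:: ayy]].

Lemma quadratic_pformE (K : fieldType) (axx axy ayy ax ay a0 : K) :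
  quadratic_pform axx axy ayy ax ay a0 =
  pcoef axx * Dx ^+ 2 + pcoef axy * (Dx * Dy) + pcoef ayy * Dy ^+ 2
  + pcoef ax * Dx + pcoef ay * Dy + pcoef a0.
Proof.
rewrite /quadratic_pform /= !cons_poly_def /Dx /Dy /pcoef; ring.
Qed.

Lemma coef_quadratic_pform (K : fieldType) (axx axy ayy ax ay a0 : K) j i :
  (quadratic_pform axx axy ayy ax ay a0)`_j`_i =
  (nth [::] [:: [:: a0; ax; axx]; [:: ay; axy]; [:: ayy]] j)`_i.
Proof.
rewrite coef_Poly.
case: j => [|[|[|j]]]; [exact: coef_Poly.. |].
by rewrite !nth_default // size_poly0.
Qed.

Lemma quadratic_pform_specializes (x y : rat1 C) axx axy ayy ax ay a0
  bxx bxy byy bx b_y b0 :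
  rat2_specializes x y axx bxx -> rat2_specializes x y axy bxy ->
  rat2_specializes x y ayy byy -> rat2_specializes x y ax bx ->
  rat2_specializes x y ay b_y -> rat2_specializes x y a0 b0 ->
  pde_specializes x y (quadratic_pform axx axy ayy ax ay a0)
                      (quadratic_pform bxx bxy byy bx b_y b0).
Proof.
move=> hxx hxy hyy hx hy h0 i j.
rewrite !coef_quadratic_pform.
by case: j => [|[|[|j]]]; case: i => [|[|[|i]]] //=; rewrite ?nth_nil //;
  exact: specializes0.
Qed.

Lemma map_quadratic_pform (K : fieldType) (f : K -> K) axx axy ayy ax ay a0 :
  f 0 = 0 -> map_poly (map_poly f) (quadratic_pform axx axy ayy ax ay a0) =
  quadratic_pform (f axx) (f axy) (f ayy) (f ax) (f ay) (f a0).
Proof.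
move=> f0; apply/polyP => j; apply/polyP => i.
rewrite coef_map_id0 ?map_poly0 // coef_map_id0 // !coef_quadratic_pform.
by case: j => [|[|[|j]]]; case: i => [|[|[|i]]] //=; rewrite ?nth_nil.
Qed.

Lemma add_quadratic_pform (K : fieldType)
    (axx axy ayy ax ay a0 bxx bxy byy bx b_y b0 : K) :
  quadratic_pform axx axy ayy ax ay a0 + quadratic_pform bxx bxy byy bx b_y b0 =
  quadratic_pform (axx + bxx) (axy + bxy) (ayy + byy)
    (ax + bx) (ay + b_y) (a0 + b0).
Proof. by rewrite !quadratic_pformE /pcoef; ring. Qed.

Lemma scale_quadratic_pform (K : fieldType) (c axx axy ayy ax ay a0 : K) :
  pcoef c * quadratic_pform axx axy ayy ax ay a0 =
  quadratic_pform (c * axx) (c * axy) (c * ayy) (c * ax) (c * ay) (c * a0).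
Proof. by rewrite !quadratic_pformE /pcoef; ring. Qed.

(** First-order forms suffice here: a second-order ODE needs [chain_ddt] applied only to 1 and to
    its first derivative. *)
Lemma mulDx_quadratic_pform (K : fieldType) (c ax ay a0 : K) :
  pcoef c * Dx * quadratic_pform 0 0 0 ax ay a0 =
  quadratic_pform (c * ax) (c * ay) 0 (c * a0) 0 0.
Proof. by rewrite !quadratic_pformE /pcoef; ring. Qed.

Lemma mulDy_quadratic_pform (K : fieldType) (c ax ay a0 : K) :
  pcoef c * Dy * quadratic_pform 0 0 0 ax ay a0 =
  quadratic_pform 0 (c * ax) (c * ay) 0 (c * a0) 0.
Proof. by rewrite !quadratic_pformE /pcoef; ring. Qed.

Lemma quadratic_pform1 (K : fieldType) :
  1 = quadratic_pform 0 0 0 0 0 1 :> pform K.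
Proof. by rewrite quadratic_pformE /pcoef !polyC0 !mul0r !add0r. Qed.

Lemma chain_ddt_quadratic_pform (x y ax ay a0 : rat1 C) :
  chain_ddt x y (quadratic_pform 0 0 0 ax ay a0) =
  quadratic_pform (ddt x * ax) (ddt x * ay + ddt y * ax) (ddt y * ay)
    (ddt ax + ddt x * a0) (ddt ay + ddt y * a0) (ddt a0).
Proof.
rewrite /chain_ddt map_quadratic_pform ?ddt0 //.
rewrite mulDx_quadratic_pform mulDy_quadratic_pform !add_quadratic_pform.
by rewrite !addr0 !add0r.
Qed.

Definition ode2 (e2 e1 e0 : rat1 C) : ode C := Poly [:: e0; e1; e2].

(** A nonzero [e2] keeps [Poly] from trimming the list, which fixes the order at two and the leading
    coefficient at [e2]. *)
Lemma polyseq_ode2 e2 e1 e0 : e2 != 0 -> ode2 e2 e1 e0 = [:: e0; e1; e2] :> seq _.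
Proof. by move=> h; apply: (@PolyK _ 0). Qed.

Lemma sum_quadratic_pform (K : fieldType)
    (e2 e1 e0 x1 y1 x2 y2 : K) :
  pcoef e0 * 1 + (pcoef e1 * quadratic_pform 0 0 0 x1 y1 0
    + pcoef e2 * quadratic_pform (x1 * x1) (x1 * y1 + y1 * x1) (y1 * y1) x2 y2 0)
  = quadratic_pform (e2 * (x1 * x1)) (e2 * (x1 * y1 + y1 * x1))
    (e2 * (y1 * y1)) (e1 * x1 + e2 * x2) (e1 * y1 + e2 * y2) e0.
Proof. by rewrite !quadratic_pformE /pcoef; ring. Qed.

Lemma chain_ddt1 (x y : rat1 C) :
  chain_ddt x y 1 = quadratic_pform 0 0 0 (ddt x) (ddt y) 0.
Proof.
rewrite quadratic_pform1 chain_ddt_quadratic_pform ddt1 ddt0.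
by congr quadratic_pform; rewrite ?mulr0 ?mulr1 ?add0r.
Qed.

Lemma chain_ddt2 (x y : rat1 C) :
  chain_ddt x y (chain_ddt x y 1) =
  quadratic_pform (ddt x * ddt x) (ddt x * ddt y + ddt y * ddt x)
    (ddt y * ddt y) (ddt (ddt x)) (ddt (ddt y)) 0.
Proof.
rewrite chain_ddt1 chain_ddt_quadratic_pform ddt0.
by congr quadratic_pform; rewrite ?mulr0 ?addr0.
Qed.

Lemma partial_diff_form_ode2 (x y e2 e1 e0 : rat1 C) : e2 != 0 ->
  partial_diff_form x y (ode2 e2 e1 e0) =
  quadratic_pform (e2 * (ddt x * ddt x)) (e2 * (ddt x * ddt y + ddt y * ddt x))
    (e2 * (ddt y * ddt y)) (e1 * ddt x + e2 * ddt (ddt x))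
    (e1 * ddt y + e2 * ddt (ddt y)) e0.
Proof.
move=> e20; rewrite /partial_diff_form polyseq_ode2 //.
rewrite !big_ord_recl big_ord0 addr0 /=.
rewrite chain_ddt2 chain_ddt1; exact: sum_quadratic_pform.
Qed.
End SecondOrderForms.

(** * Regular singularities of second-order equations *)

Section Fuchsian.
Variable C : fieldType.

Lemma tvar_neq0 : tvar != 0 :> rat1 C.
Proof. by rewrite tofrac_eq0 polyX_eq0. Qed.

(** This is t^n p(1/t) for a nominal degree n. It may exceed the degree of p, so upper bounds on the
    degrees of the lower coefficients suffice. *)
Definition reverse_poly (n : nat) (p : {poly C}) : {poly C} :=
  \poly_(i < n.+1) p`_(n - i).

Lemma horner0_reverse_poly n p : (reverse_poly n p).[0] = p`_n.
Proof. by rewrite horner_coef0 coef_poly subn0. Qed.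

Lemma subst1_tvarV n (p : {poly C}) : (size p <= n.+1)%N ->
  subst1 tvar^-1 p = (reverse_poly n p)%:F / tvar ^+ n.
Proof.
move=> hp; have t0 := tvar_neq0.
apply: (canRL (mulfK (expf_neq0 n t0))).
rewrite /subst1 (@horner_coef_wide _ n.+1); last first.
  by rewrite (leq_trans (size_poly _ _)).
rewrite /reverse_poly poly_def rmorph_sum mulr_suml.
rewrite (reindex_inj rev_ord_inj); apply: eq_bigr => i _.
rewrite coef_map_id0 ?rmorph0 // /= subSS -mulrA -mul_polyC tofracM tofracXn.
have le_in : (i <= n)%N by rewrite -ltnS.
congr (_ * _); rewrite -[X in _ * _ ^+ X](subnK le_in) exprD mulrA -exprMn.
by rewrite mulVf // expr1n mul1r.
Qed.

(** Reversed at its exact degree, p has its leading coefficient as constant term. Hence the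
    denominator chosen in [subst_inv] survives t -> 1/t. *)
Lemma subst1_tvarV_neq0 (p : {poly C}) : p != 0 -> subst1 tvar^-1 p != 0.
Proof.
move=> p0; rewrite (@subst1_tvarV (size p).-1); last exact: leqSpred.
apply: mulf_neq0; last exact: invr_neq0 (expf_neq0 _ tvar_neq0).
rewrite tofrac_eq0; apply: contra_neq p0 => r0.
by apply/eqP; rewrite -lead_coef_eq0 lead_coefE -horner0_reverse_poly r0 horner0.
Qed.

Lemma subst_inv_tofrac (p : {poly C}) : subst_inv p%:F = subst1 tvar^-1 p.
Proof.
rewrite /subst_inv repr_tofrac (rmorphM (subst1 tvar^-1)).
by apply: mulfK; apply: subst1_tvarV_neq0; exact: denom_ratioP.
Qed.

Lemma coef_ode2 (e2 e1 e0 : rat1 C) i : (ode2 e2 e1 e0)`_i = [:: e0; e1; e2]`_i.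
Proof. exact: coef_Poly. Qed.

Lemma regular_at_ode2 t0 (e2 e1 e0 : rat1 C) : e2 != 0 ->
  holomorphic_at t0 ((tvar - cst1 t0) * (e1 / e2)) ->
  holomorphic_at t0 ((tvar - cst1 t0) ^+ 2 * (e0 / e2)) ->
  regular_at t0 (ode2 e2 e1 e0).
Proof.
move=> e20 h1 h0 k; rewrite /ode_order lead_coefE polyseq_ode2 //=.
case: k => [|[|[|k]]] //= _; rewrite divff // mulr1.
by exists 1, 1; rewrite hornerC oner_neq0 tofrac1 divr1.
Qed.

Lemma inv_ddt_ode2 (e1 e0 : rat1 C) :
  inv_ddt (ode2 0 e1 e0) =
  ode2 (- tvar ^+ 2 * e1) (- tvar ^+ 2 * (ddt e1 + e0)) (- tvar ^+ 2 * ddt e0).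
Proof.
rewrite /inv_ddt; set c := - _; apply/polyP => i.
rewrite coefZ coefD coef_map_id0 ?ddt0 // coefXM !coef_ode2.
case: i => [|[|[|[|i]]]] /=; rewrite ?nth_nil ?ddt0 ?addr0 ?add0r ?mulr0 //.
Qed.

Lemma inv_ddt1 : inv_ddt 1 = ode2 0 (- tvar ^+ 2) 0 :> ode C.
Proof.
have -> : 1 = ode2 0 0 1 :> ode C.
  by apply/polyP => -[|[|[|i]]]; rewrite coef_ode2 coef1 //= nth_nil.
by rewrite inv_ddt_ode2 ddt0 ddt1; congr ode2; rewrite ?mulr0 ?add0r ?mulr1.
Qed.

Lemma ddt_opp_sqr_tvar : ddt (- tvar ^+ 2) = - (2 * tvar) :> rat1 C.
Proof.
rewrite -tofracXn -tofracN ddt_tofrac derivN derivXn /= expr1 tofracN.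
by rewrite -mulr_natl tofracM rmorph_nat.
Qed.

Lemma inv_ddt2 :
  inv_ddt (inv_ddt 1) = ode2 (tvar ^+ 4) (2 * tvar ^+ 3) 0 :> ode C.
Proof.
rewrite inv_ddt1 inv_ddt_ode2 ddt_opp_sqr_tvar ddt0; congr ode2.
- by rewrite mulrNN -exprD.
- by rewrite addr0 mulrNN mulrCA -exprSr.
- by rewrite mulr0.
Qed.

(** With z = 1/t, d/dt = - z^2 d/dz and d^2/dt^2 = z^4 d^2/dz^2 + 2 z^3 d/dz. *)
Lemma ode_at_infinity_ode2 (e2 e1 e0 : rat1 C) : e2 != 0 ->
  ode_at_infinity (ode2 e2 e1 e0) =
  ode2 (tvar ^+ 4 * subst_inv e2)
       (2 * tvar ^+ 3 * subst_inv e2 - tvar ^+ 2 * subst_inv e1)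
       (subst_inv e0).
Proof.
move=> e20; rewrite /ode_at_infinity polyseq_ode2 //.
rewrite !big_ord_recl big_ord0 addr0 /=.
rewrite inv_ddt2 inv_ddt1; apply/polyP => i.
rewrite !coefD !coefZ coef1 !coef_ode2.
case: i => [|[|[|i]]] /=; rewrite ?nth_nil ?mulr0 ?addr0 ?add0r ?mulr1 //.
- by rewrite mulrN addrC mulrC [X in _ - X]mulrC.
- by rewrite mulrC.
Qed.

Lemma holomorphic_at_div t0 (n d : {poly C}) : d.[t0] != 0 ->
  holomorphic_at t0 (n%:F / d%:F).
Proof. by move=> d0; exists n, d. Qed.

(** Since the nominal degree drops by one from [e2] to [e1], all powers of the local parameter
    cancel. What is left is holomorphic at 0 once r2 does not vanish there. *)
Lemma first_coef_at_infinity (K : fieldType) (t r2 r1 : K) d : t != 0 -> r2 != 0 ->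
  t * ((2 * t ^+ 3 * (r2 / t ^+ d.+2) - t ^+ 2 * (r1 / t ^+ d.+1))
    / (t ^+ 4 * (r2 / t ^+ d.+2))) = (2 * r2 - r1) / r2.
Proof.
move=> t0 r0; have := expf_neq0 d t0.
rewrite -[d.+2]addn2 -[d.+1]addn1 !exprD expr1.
by move: (t ^+ d) => u u0; field; rewrite t0 r0 u0.
Qed.

Lemma zeroth_coef_at_infinity (K : fieldType) (t r2 r0 : K) d : t != 0 -> r2 != 0 ->
  t ^+ 2 * ((r0 / t ^+ d) / (t ^+ 4 * (r2 / t ^+ d.+2))) = r0 / r2.
Proof.
move=> t0 r20; have := expf_neq0 d t0; rewrite -[d.+2]addn2 exprD.
by move: (t ^+ d) => u u0; field; rewrite t0 r20 u0.
Qed.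

(** If e(t0) is nonzero, e itself is the denominator. Otherwise e = q (t - t0), and q(t0) = e'(t0)
    is nonzero by simplicity. *)
Lemma simple_pole t0 (e : {poly C}) : e != 0 ->
    (e.[t0] = 0 -> e^`().[t0] != 0) ->
  exists n q : {poly C},
    q.[t0] != 0 /\ (tvar - cst1 t0) / e%:F = n%:F / q%:F.
Proof.
move=> e0 simple; have [|] := eqVneq e.[t0] 0; last first.
  by exists ('X - t0%:P), e; rewrite tofracB.
move=> et0; have /factor_theorem [q eq] : root e t0 by apply/eqP.
exists 1, q; split.
  have := simple et0.
  by rewrite eq derivM !hornerE subrr mulr0 derivXsubC hornerC mulr1 add0r.
move: e0; rewrite eq mulf_eq0 negb_or => /andP [q0 r0].
rewrite -tofracB tofracM invfM mulrCA mulfV ?tofrac_eq0 // mulr1.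
by rewrite tofrac1 mul1r.
Qed.

(** Sizes exceed degrees by one: [e2] has degree exactly d + 2, the others at most d + 1 and d.
    Simple roots of [e2] settle the finite points, the degree bounds settle infinity. *)
Lemma fuchsian_ode2 (d : nat) (e2 e1 e0 : {poly C}) :
    size e2 = d.+3 -> (size e1 <= d.+2)%N -> (size e0 <= d.+1)%N ->
    (forall t0, e2.[t0] = 0 -> e2^`().[t0] != 0) ->
  fuchsian (ode2 e2%:F e1%:F e0%:F).
Proof.
move=> s2 s1 s0 simple.
have e20 : e2 != 0 by rewrite -size_poly_gt0 s2.
have E20 : e2%:F != 0 :> rat1 C by rewrite tofrac_eq0.
split.
- by rewrite -size_poly_gt0 polyseq_ode2.
- move=> t0; have [n [q [q0 eq]]] := simple_pole e20 (simple t0).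
  apply: regular_at_ode2 => //.
  + by rewrite mulrCA eq mulrA -tofracM; exact: holomorphic_at_div.
  (* One factor t - t0 absorbs the simple pole, the other stays in the numerator. *)
  + rewrite expr2 -mulrA (mulrCA (tvar - cst1 t0) e0%:F) eq -tofracB.
    by rewrite !mulrA -!tofracM; exact: holomorphic_at_div.
- set r2 := reverse_poly d.+2 e2.
  (* The reversal is at the exact degree of [e2], so its value at 0 is the leading coefficient. *)
  have r20 : r2.[0] != 0.
    by rewrite horner0_reverse_poly -[d.+2]/(d.+3.-1) -s2 -lead_coefE lead_coef_eq0.
  have R20 : r2%:F != 0 :> rat1 C.
    by rewrite tofrac_eq0; apply: contra_neq r20 => ->; rewrite horner0.
  have t0 := tvar_neq0.
  rewrite ode_at_infinity_ode2 // !subst_inv_tofrac (@subst1_tvarV d.+2) ?s2 //.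
  rewrite (subst1_tvarV s1) (subst1_tvarV s0).
  apply: regular_at_ode2.
  + exact: mulf_neq0 (expf_neq0 4 t0)
      (mulf_neq0 R20 (invr_neq0 (expf_neq0 d.+2 t0))).
  + rewrite rmorph0 subr0 (first_coef_at_infinity _ _ t0 R20) -(rmorph_nat (@FracField.tofrac _)).
    by rewrite -tofracM -tofracB; exact: holomorphic_at_div.
  + by rewrite rmorph0 subr0 (zeroth_coef_at_infinity _ _ t0 R20); exact: holomorphic_at_div.
Qed.
End Fuchsian.

(** * Combinations of the two F2 equations *)

Section F2Combination.

(** With abstract coefficients over any field, [ring] sees the constants of the equation as
    atoms. *)
Lemma F2_eq1_quadratic_pform (K : fieldType) (x y c1 a1 b1 ab1 : K) :
  pcoef (x * (1 - x)) * Dx ^+ 2 - pcoef (x * y) * (Dx * Dy)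
  + pcoef (c1 - a1 * x) * Dx - pcoef (b1 * y) * Dy - pcoef ab1 =
  quadratic_pform (x * (1 - x)) (- (x * y)) 0 (c1 - a1 * x) (- (b1 * y)) (- ab1).
Proof. by rewrite quadratic_pformE /pcoef; ring. Qed.

Lemma F2_eq2_quadratic_pform (K : fieldType) (x y c2 a2 b2 ab2 : K) :
  pcoef (y * (1 - y)) * Dy ^+ 2 - pcoef (x * y) * (Dx * Dy)
  + pcoef (c2 - a2 * y) * Dy - pcoef (b2 * x) * Dx - pcoef ab2 =
  quadratic_pform 0 (- (x * y)) (y * (1 - y)) (- (b2 * x)) (c2 - a2 * y) (- ab2).
Proof. by rewrite quadratic_pformE /pcoef; ring. Qed.

Variable C : fieldType.

Lemma F2_eq1E (a b1 c1 : C) :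
  F2_eq1 a b1 c1 =
  quadratic_pform (xvar * (1 - xvar)) (- (xvar * yvar)) 0
    (cst2 c1 - cst2 (a + b1 + 1) * xvar) (- (cst2 b1 * yvar)) (- cst2 (a * b1)).
Proof. exact: F2_eq1_quadratic_pform. Qed.

Lemma F2_eq2E (a b2 c2 : C) :
  F2_eq2 a b2 c2 =
  quadratic_pform 0 (- (xvar * yvar)) (yvar * (1 - yvar))
    (- (cst2 b2 * xvar)) (cst2 c2 - cst2 (a + b2 + 1) * yvar) (- cst2 (a * b2)).
Proof. exact: F2_eq2_quadratic_pform. Qed.

(** The products with 0 are left unsimplified so that the form splits syntactically into two scaled
    equations. *)
Lemma F2_combination_follows (a b1 b2 c1 c2 : C) (g1 g2 : rat2 C) :
  pde_follows (F2_system a b1 b2 c1 c2)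
    (quadratic_pform (g1 * (xvar * (1 - xvar)) + g2 * 0)
       (g1 * - (xvar * yvar) + g2 * - (xvar * yvar))
       (g1 * 0 + g2 * (yvar * (1 - yvar)))
       (g1 * (cst2 c1 - cst2 (a + b1 + 1) * xvar) + g2 * - (cst2 b2 * xvar))
       (g1 * - (cst2 b1 * yvar) + g2 * (cst2 c2 - cst2 (a + b2 + 1) * yvar))
       (g1 * - cst2 (a * b1) + g2 * - cst2 (a * b2))).
Proof.
rewrite -add_quadratic_pform -!scale_quadratic_pform -F2_eq1E -F2_eq2E.
apply: follows_add; apply: follows_mul; apply: follows_mem.
  exact: mem_head.
by rewrite in_cons mem_head orbT.
Qed.

Lemma F2_combination_specializes (a b1 b2 c1 c2 : C) (x y h1 h2 : rat1 C)
    (g1 g2 : rat2 C) :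
  rat2_specializes x y g1 h1 -> rat2_specializes x y g2 h2 ->
  pde_specializes x y
    (quadratic_pform (g1 * (xvar * (1 - xvar)) + g2 * 0)
       (g1 * - (xvar * yvar) + g2 * - (xvar * yvar))
       (g1 * 0 + g2 * (yvar * (1 - yvar)))
       (g1 * (cst2 c1 - cst2 (a + b1 + 1) * xvar) + g2 * - (cst2 b2 * xvar))
       (g1 * - (cst2 b1 * yvar) + g2 * (cst2 c2 - cst2 (a + b2 + 1) * yvar))
       (g1 * - cst2 (a * b1) + g2 * - cst2 (a * b2)))
    (quadratic_pform (h1 * (x * (1 - x)) + h2 * 0)
       (h1 * - (x * y) + h2 * - (x * y))
       (h1 * 0 + h2 * (y * (1 - y)))
       (h1 * (cst1 c1 - cst1 (a + b1 + 1) * x) + h2 * - (cst1 b2 * x))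
       (h1 * - (cst1 b1 * y) + h2 * (cst1 c2 - cst1 (a + b2 + 1) * y))
       (h1 * - cst1 (a * b1) + h2 * - cst1 (a * b2))).
Proof.
move=> hg1 hg2.
have X := specializes_xvar x y; have Y := specializes_yvar x y.
have I := specializes1 x y; have O := specializes0 x y.
have K := specializes_cst x y.
have N := @specializesN _ x y; have M := @specializesM _ x y.
have D := @specializesD _ x y.
(* Each coefficient is a ring expression in x, y, constants and g1, g2; the proof terms mirror that
   expression. *)
apply: quadratic_pform_specializes.
- exact: D _ _ _ _ (M _ _ _ _ hg1 (M _ _ _ _ X (D _ _ _ _ I (N _ _ X))))
    (M _ _ _ _ hg2 O).
- exact: D _ _ _ _ (M _ _ _ _ hg1 (N _ _ (M _ _ _ _ X Y)))
    (M _ _ _ _ hg2 (N _ _ (M _ _ _ _ X Y))).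
- exact: D _ _ _ _ (M _ _ _ _ hg1 O)
    (M _ _ _ _ hg2 (M _ _ _ _ Y (D _ _ _ _ I (N _ _ Y)))).
- exact: D _ _ _ _
    (M _ _ _ _ hg1 (D _ _ _ _ (K c1) (N _ _ (M _ _ _ _ (K _) X))))
    (M _ _ _ _ hg2 (N _ _ (M _ _ _ _ (K b2) X))).
- exact: D _ _ _ _ (M _ _ _ _ hg1 (N _ _ (M _ _ _ _ (K b1) Y)))
    (M _ _ _ _ hg2 (D _ _ _ _ (K c2) (N _ _ (M _ _ _ _ (K _) Y)))).
- exact: D _ _ _ _ (M _ _ _ _ hg1 (N _ _ (K _))) (M _ _ _ _ hg2 (N _ _ (K _))).
Qed.

(** Comparing the six coefficients of the chain-rule form with those of the restricted combination
    leaves only identities in [{poly C}]. The multipliers [g1], [g2] live on the plane, and [h1],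
    [h2] are their restrictions to the curve. *)
Lemma F2_specialization_criterion (a b1 b2 c1 c2 : C) (x y h1 h2 : {poly C})
    (g1 g2 : rat2 C) (e2 e1 e0 : {poly C}) :
    rat2_specializes x%:F y%:F g1 h1%:F -> rat2_specializes x%:F y%:F g2 h2%:F ->
    e2 != 0 ->
    e2 * (x^`() * x^`()) = h1 * (x * (1 - x)) + h2 * 0 ->
    e2 * (x^`() * y^`() + y^`() * x^`()) = h1 * - (x * y) + h2 * - (x * y) ->
    e2 * (y^`() * y^`()) = h1 * 0 + h2 * (y * (1 - y)) ->
    e1 * x^`() + e2 * x^`()^`() =
      h1 * (c1%:P - (a + b1 + 1)%:P * x) + h2 * - (b2%:P * x) ->
    e1 * y^`() + e2 * y^`()^`() =
      h1 * - (b1%:P * y) + h2 * (c2%:P - (a + b2 + 1)%:P * y) ->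
    e0 = h1 * - (a * b1)%:P + h2 * - (a * b2)%:P ->
  F2_specialization_satisfies a b1 b2 c1 c2 x%:F y%:F
    (ode2 e2%:F e1%:F e0%:F).
Proof.
move=> hg1 hg2 e20 hxx hxy hyy hx hy h0.
eexists; first exact: (F2_combination_follows a b1 b2 c1 c2 g1 g2).
rewrite partial_diff_form_ode2; last by rewrite tofrac_eq0.
rewrite !ddt_tofrac -!tofracM -!tofracD -!tofracM hxx hxy hyy hx hy h0.
rewrite !(tofracD, tofracM, tofracN, tofrac0, tofrac1).
exact: F2_combination_specializes hg1 hg2.
Qed.
End F2Combination.

(** * The line and the conic *)

Section Curves.
Variable C : fieldType.
Hypothesis two_neq0 : 2 != 0 :> C.

Lemma F2_line (a b1 b2 : C) :
  exists E : ode C, [/\ ode_order E = 2%N, fuchsian E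
    & F2_specialization_satisfies a b1 b2 (2 * b1) (2 * b2) tvar (2 - tvar) E].
Proof.
pose e2 : {poly C} := Poly [:: 0; 2; - 3; 1].
(* As x' = 1 and x'' = 0, this is the Fx coefficient (2 - t)(2 b1 - (a + b1 + 1) t) + b2 t^2 of the
   combination. The Fy coefficient is its negative, matching y' = -1. *)
pose e1 : {poly C} :=
  Poly [:: 4 * b1; - (2 * (a + 2 * b1 + 1)); a + b1 + b2 + 1].
pose e0 : {poly C} := Poly [:: - (2 * a * b1); a * b1 + a * b2].
have e2E : e2 = 'X * (2 - 'X) * (1 - 'X).
  by rewrite /e2 /= !cons_poly_def; ring.
have size_e2 : size e2 = 4 by rewrite (PolyK (c := 0)) ?oner_neq0.
have e2_neq0 : e2 != 0 by rewrite -size_poly_gt0 size_e2.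
exists (ode2 e2%:F e1%:F e0%:F); split.
- by rewrite /ode_order polyseq_ode2 // tofrac_eq0.
- apply: (@fuchsian_ode2 _ 1%N) => //; rewrite ?(leq_trans (size_Poly _)) //.
  (* At the roots 0, 2 and 1 the derivative is 2, 2 and -1. *)
  move=> t0; rewrite e2E !derivE !hornerE => /eqP.
  rewrite !mulf_eq0 !subr_eq0 -orbA => /or3P [/eqP ->|/eqP <-|/eqP <-].
  + by rewrite (_ : _ + _ = 2) //; ring.
  + by rewrite (_ : _ + _ = 2) //; ring.
  + by rewrite (_ : _ + _ = - 1) ?oppr_eq0 ?oner_neq0 //; ring.
- have -> : 2 - tvar = (2 - 'X)%:F :> rat1 C by rewrite tofracB rmorph_nat.
  apply: (@F2_specialization_criterion _ _ _ _ _ _ 'X (2 - 'X) (2 - 'X) (- 'X)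
    yvar (- xvar)) => //.
  + exact: specializes_yvar.
  + by rewrite tofracN; apply: specializesN; exact: specializes_xvar.
  all: rewrite ?e2E /e1 /e0 /= ?cons_poly_def ?derivE; by ring.
Qed.

(** The relation on a is stated without halves, so that it can be used as a polynomial relation over
    the integers. *)
Lemma F2_conic (a b1 b2 s : C) : 2 * a = 2 * b1 + 2 * b2 - 1 -> s ^+ 2 != 1 ->
  exists E : ode C, [/\ ode_order E = 2%N, fuchsian E
    & F2_specialization_satisfies a b1 b2 (2 * b1) (2 * b2)
        (1 - tvar ^+ 2) (1 - (tvar + cst1 s) ^+ 2 / cst1 (s ^+ 2 - 1)) E].
Proof.
move=> ha hs.
pose e2 : {poly C} := Poly [:: -1; - (2 * s); 0; 2 * s; 1].
(* This is 4 b1 t (t^2 + 2 s t + 1) + 4 b2 (t^2 - 1)(t + s), that is e2 (2 b1 x'/x + 2 b2 y'/y). It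
   comes from the Fx condition divided by x' = -2 t; the relation on a makes that division exact. *)
pose e1 : {poly C} := Poly [:: - (4 * b2 * s); 4 * b1 - 4 * b2;
  8 * b1 * s + 4 * b2 * s; 4 * b1 + 4 * b2].
pose e0 : {poly C} := Poly [:: 4 * a * b1 - 4 * a * b2; 8 * a * b1 * s;
  4 * a * b1 + 4 * a * b2].
(* Here x = 1 - t^2 and k y = -(t^2 + 2 s t + 1), so the product is k x y. *)
have e2E : e2 = ('X ^+ 2 - 1) * ('X ^+ 2 + 2 * s%:P * 'X + 1).
  by rewrite /e2 /= !cons_poly_def; ring.
have size_e2 : size e2 = 5 by rewrite (PolyK (c := 0)) ?oner_neq0.
have e2_neq0 : e2 != 0 by rewrite -size_poly_gt0 size_e2.
exists (ode2 e2%:F e1%:F e0%:F); split.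
- by rewrite /ode_order polyseq_ode2 // tofrac_eq0.
- apply: (@fuchsian_ode2 _ 2%N) => //; rewrite ?(leq_trans (size_Poly _)) //.
  move=> t0; rewrite e2E !derivE !hornerE => h; apply/eqP => h'.
  have four_neq0 : 4 != 0 :> C.
    by rewrite (_ : 4 = 2 * 2) ?mulf_neq0 //; ring.
  have {h'} h' : 2 * t0 * (t0 ^+ 2 + 2 * s * t0 + 1)
      + (t0 ^+ 2 - 1) * (2 * (t0 + s)) = 0 by rewrite -[RHS]h' /=; ring.
  (* A multiple root would force s^2 = 1. If t0^2 = 1, the two equations give t0 = -s; if t0 = -s is
     a root of the second factor, that factor equals 1 - s^2 there. *)
  case/eqP: hs; move/eqP: h; rewrite mulf_eq0 => /orP [] /eqP h.
  + have t1 : t0 ^+ 2 = 1 by apply/eqP; rewrite -subr_eq0 h.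
    have : 4 * (t0 + s) = 0 by rewrite -[RHS]h'; ring: t1.
    move/eqP; rewrite mulf_eq0 (negbTE four_neq0) addrC addr_eq0 => /eqP ->.
    by rewrite sqrrN.
  + move/eqP: h'; rewrite h mulr0 add0r !mulf_eq0 (negbTE two_neq0) orbCA /=.
    rewrite (addrC t0 s) subr_eq0 addr_eq0 => /orP [/eqP t1|/eqP st].
    * have : 2 * (t0 + s) = 0.
        by rewrite -[RHS](mulr0 t0) -h; ring: t1.
      move/eqP; rewrite mulf_eq0 (negbTE two_neq0) addrC addr_eq0 => /eqP ->.
      by rewrite sqrrN.
    * by rewrite -[LHS]addr0 -h st; ring.
(* With w a constant subject to k w = 1, the curve is polynomial in t, and [ring] works modulo this
   relation and s^2 = k + 1. *)
- pose k := s ^+ 2 - 1; pose w := k^-1.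
  have k0 : k != 0 by rewrite subr_eq0.
  have kw : k * w = 1 by rewrite mulfV.
  have sk : s ^+ 2 = k + 1 by rewrite subrK.
  have kwP : k%:P * w%:P = 1 by rewrite -polyCM kw.
  have skP : s%:P ^+ 2 = k%:P + 1 by rewrite -polyC_exp sk polyCD.
  (* The two first-order conditions hold only modulo the relation on a, with cofactor Z. On the
     right-hand sides a occurs as -4 k a x y and -4 a x y, which yields Z = 2 k x y and Z = 2 x
     y. *)
  have mod_ha Z p q :
      p = q + Z * (2 * a - (2 * b1 + 2 * b2 - 1))%:P -> p = q :> {poly C}.
    by rewrite ha subrr polyC0 mulr0 addr0.
  have -> : 1 - tvar ^+ 2 = (1 - 'X ^+ 2)%:F :> rat1 C.
    by rewrite tofracB tofracXn.
  have -> : 1 - (tvar + cst1 s) ^+ 2 / cst1 k =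
      (1 - ('X + s%:P) ^+ 2 * w%:P)%:F :> rat1 C.
    by rewrite -fmorphV tofracB tofracM tofracXn tofracD.
  apply: (@F2_specialization_criterion _ _ _ _ _ _ _ _
    ((4 * k)%:P * (1 - ('X + s%:P) ^+ 2 * w%:P)) (4%:P * (1 - 'X ^+ 2))
    (cst2 (4 * k) * yvar) (cst2 4 * xvar)) => //.
  + rewrite tofracM; apply: specializesM; first exact: specializes_cst.
    exact: specializes_yvar.
  + rewrite tofracM; apply: specializesM; first exact: specializes_cst.
    exact: specializes_xvar.
  all: rewrite ?e2E /e1 /e0 /= ?cons_poly_def ?derivE.
  + by ring: kwP skP.
  + by ring: kwP skP.
  + by ring: kwP skP.
  + apply: (mod_ha (2 * k%:P * (1 - 'X ^+ 2) * (1 - ('X + s%:P) ^+ 2 * w%:P))).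
    by ring: kwP skP.
  + apply: (mod_ha (2 * (1 - 'X ^+ 2) * (1 - ('X + s%:P) ^+ 2 * w%:P))).
    by ring: kwP skP.
  + by ring: kwP skP.
Qed.
End Curves.

Local Open Scope complex_scope.

Theorem theorem2p2 (R : realType) (a b1 b2 s : R[i]) (hs : s ^+ 2 <> 1) :
  (exists E : ode R[i],
     [/\ ode_order E = 2%N, fuchsian E
       & F2_specialization_satisfies a b1 b2 (2 * b1) (2 * b2)
           tvar (2 - tvar) E])
  /\
  (exists E : ode R[i],
     [/\ ode_order E = 2%N, fuchsian E
       & F2_specialization_satisfies (b1 + b2 - 2^-1) b1 b2 (2 * b1) (2 * b2)
           (1 - tvar ^+ 2)
           (1 - (tvar + cst1 s) ^+ 2 / cst1 (s ^+ 2 - 1)) E]).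
Proof.
have two_neq0 : 2 != 0 :> R[i] by rewrite Num.Theory.pnatr_eq0.
split; first exact: F2_line.
apply: F2_conic => //; last exact/eqP.
by rewrite mulrBr mulrDr mulfV.
Qed.
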